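(* Let $M=\{r=0\}\subset\mathbb{C}^{n+1}$ be the boundary of a sum of squares domain, $r=2\,\mathrm{Re}(z_{n+1})+\sum_{i=1}^{N}|f_i(z_1,\dots,z_n)|^2$ with $f_1,\dots,f_N$ holomorphic near the origin and vanishing there, and assume that the D'Angelo 1-type of $M$ at $0$ is finite. At step $j$ of the Kolář algorithm for the computation of the multitype at $0$, let $P_j$ be the leading polynomial, let $Q_j$ be the leftover polynomial, and let $A_{P_j}$ be the Levi matrix of $P_j$. Let $k$ be given, $1\le k\le n$. There exists an allowable polynomial transformation on $P_j$ with respect to the variable $z_k$ if and only if the $k$-th row of $A_{P_j}$ is dependent.
   Context: Levi matrix: $A_{P_j}=\left(\partial^2P_j/\partial z_a\partial\bar z_b\right)_{1\le a,b\le n}$, with rows $R_1,\dots,R_n$. The row $R_k$ is dependent if $R_k=\sum_{l\ne k}\alpha_lR_l$ with $\alpha_l\in\mathbb{C}[z]=\mathbb{C}[z_1,\dots,z_n]$ and $\alpha_l\ne0$ for at least one $l$. A polynomial change of variables at step $j$ of the algorithm (a $\Lambda_j$-homogeneous transformation, see below) is allowable with respect to $z_k$ if it eliminates the occurrence of the variable $z_k$ from the leading polynomial $P_j$ and reduces the number of variables in $P_j$ by at least one. The D'Angelo 1-type of $M$ at $0$ is $\sup_\varphi \mathrm{ord}_0(r\circ\varphi)/\mathrm{ord}_0(\varphi)$ over nonconstant germs of holomorphic curves $\varphi:(\mathbb{C},0)\to(\mathbb{C}^{n+1},0)$. Its finiteness implies that all entries of the Catlin multitype at $0$ are finite. Weights: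 for an $n$-tuple $\Lambda=(\lambda_1,\dots,\lambda_n)$ the monomial $z^\alpha\bar z^{\hat\alpha}$ has weighted degree $|(\alpha,\hat\alpha)|_\Lambda=\sum_i(\alpha_i+\hat\alpha_i)\lambda_i$; the nontangential variable $w=u+iv=-2iz_{n+1}$ (so that $M$ is $v=F$ with $F=\sum|f_i|^2$) has weight $1$; a polynomial is $\Lambda$-homogeneous of weighted degree $\kappa$ if all its monomials have weighted degree $\kappa$. Kolář algorithm. Let $m_1$ (the Bloom–Graham type) be the lowest degree of a monomial in $z,\bar z$ in $F$ (coordinates without pluriharmonic terms), $\mu_1=1/m_1$, $\Lambda_1=(\mu_1,\dots,\mu_1)$, and let the leading polynomial $P_1$ be the sum of the terms of weighted degree $1$ with respect to $\Lambda_1$. Given $\Lambda_t=(\lambda^t_1,\dots,\lambda^t_n)$ and $P_t$: among all $\Lambda_t$-homogeneous transformations ($\tilde z_i=z_i+\phi_i$, $\tilde w=w+g$, with $\phi_i$, $g$ holomorphic $\Lambda_t$-homogeneous polynomials of weighted degree $\lambda_i^t$, resp. $1$; here $z_{n+1}$ is left unchanged) choose one making $P_t$ independent of the largest number $d_t$ of variables. In the new coordinates $P_t=P_t(z_1,\dots,z_{n-d_t},\bar z_1,\dots,\bar z_{n-d_t})$ and $M$ is $v=P_t+Q_t+o(u)$ with leftover polynomial $Q_t=\sum_{|(\alpha,\hat\alpha)|_{\Lambda_t}>1}C^t_{\alpha,\hat\alpha}z^\alpha\bar z^{\hat\alpha}$. If $d_t=0$, stop; $\Lambda_t$ is the multitype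 weight. Otherwise let $\Theta_t=\{(\alpha,\hat\alpha): C^t_{\alpha,\hat\alpha}\ne0,\ \sum_{i\le n-d_t}(\alpha_i+\hat\alpha_i)\lambda^t_i<1\}$, $W_t(\alpha,\hat\alpha)=\frac{1-\sum_{i\le n-d_t}(\alpha_i+\hat\alpha_i)\lambda^t_i}{\sum_{i>n-d_t}(\alpha_i+\hat\alpha_i)}$, set $\lambda^{t+1}_i=\lambda^t_i$ for $i\le n-d_t$ and $\lambda^{t+1}_i=\max_{\Theta_t}W_t$ for $i>n-d_t$, and let $P_{t+1}$ be the sum of the terms of weighted degree $1$ with respect to $\Lambda_{t+1}$.
   Formalization: The formal version assumes z_k occurs in P_j (a zero row can be dependent with nothing to eliminate), and an allowable change must eliminate z_k, not just rename it: z_k and the other new coordinates must again form a homogeneous coordinate system. *)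

(* Defs.v *)
From HB Require Import structures.
From mathcomp Require Import all_boot all_order all_algebra complex.
(* mpoly has to be imported before MathComp-Analysis: in the other order their
   notations clash. *)
From mathcomp Require Import mpoly.
From mathcomp Require Import boolp classical_sets reals constructive_ereal.
From mathcomp Require Import ereal topology normedtype derive.
Set Implicit Arguments.
Unset Strict Implicit.
Unset Printing Implicit Defensive.
Import Order.TTheory GRing.Theory Num.Theory.
Import numFieldNormedType.Exports.
Local Open Scope classical_set_scope.
Local Open Scope ring_scope.

Local Set Warnings "-redundant-canonical-projection".
HB.instance Definition _ (R : realType) :=
  NormedModule.copy R[i] (R[i] : numClosedFieldType)^o.
Local Set Warnings "redundant-canonical-projection".

(** * Sums of squares and the D'Angelo 1-type *)

(* The scalars are R[i], so [differentiable] means complex differentiable. *)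
Definition holomorphic_near0 (R : realType) (V W : normedModType R[i])
  (h : V -> W) : Prop := \forall z \near (0 : V), differentiable h z.

(* C^(n+1) is C^n * C; the values of the norm and of 'Re are real elements of
   R[i]. *)
Definition defining_function (R : realType) (n N : nat)
    (f : 'I_N -> 'rV[R[i]]_n -> R[i]) (p : 'rV[R[i]]_n * R[i]) : R[i] :=
  2 * 'Re (p.2) + \sum_(i < N) `|f i p.1| ^+ 2.

(* The order of vanishing at 0, +oo for a function that is flat at 0. It is
   also the order of the (only real-analytic) function r o phi. *)
Definition order0 (R : realType) (V : normedModType R[i]) (h : R[i] -> V) :
    \bar R :=
  ereal_sup [set k%:R%:E | k in [set k : nat | exists M : R[i],
    \forall t \near (0 : R[i]), `|h t| <= M * `|t| ^+ k]].

Definition is_curve (R : realType) (n : nat)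
    (phi : R[i] -> 'rV[R[i]]_n * R[i]) : Prop :=
  [/\ holomorphic_near0 phi, phi 0 = 0 &
      ~ (\forall t \near (0 : R[i]), phi t = phi 0)].

Definition DAngelo_1type (R : realType) (n N : nat)
    (f : 'I_N -> 'rV[R[i]]_n -> R[i]) : \bar R :=
  ereal_sup [set (order0 (fun t => defining_function f (phi t) : R[i])
                  / order0 phi)%E | phi in @is_curve R n].

(** * Taylor coefficients of F = sum |f_i|^2 *)

Definition partial (R : realType) (n : nat) (i : 'I_n)
  (h : 'rV[R[i]]_n -> R[i]) : 'rV[R[i]]_n -> R[i] :=
  fun z => 'D_(delta_mx 0 i) h z.

Definition mpartial (R : realType) (n : nat) (a : 'X_{1..n})
    (h : 'rV[R[i]]_n -> R[i]) : 'rV[R[i]]_n -> R[i] :=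
  foldr (fun i => iter (a i) (partial i)) h (enum 'I_n).

Definition taylor_coef (R : realType) (n : nat) (h : 'rV[R[i]]_n -> R[i])
    (a : 'X_{1..n}) : R[i] :=
  mpartial a h 0 / (\prod_(i < n) (a i)`!)%:R.

(* A multi-index of 'X_{1..n + n} is a pair (alpha, alpha^): the first n
   exponents are those of z, the last n those of the conjugates; likewise in
   {mpoly R[i][n + n]} the variable lshift n i is z_i and rshift n i is its
   conjugate. *)
Definition zexp (n : nat) (m : 'X_{1..n + n}) : 'X_{1..n} :=
  [multinom m (lshift n i) | i < n].

Definition zbarexp (n : nat) (m : 'X_{1..n + n}) : 'X_{1..n} :=
  [multinom m (rshift n i) | i < n].

(* The coefficient of z^alpha zbar^alpha^ in sum_i g_i * conj g_i *)
Definition Fcoef (R : realType) (n N : nat)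
    (g : 'I_N -> 'rV[R[i]]_n -> R[i]) (m : 'X_{1..n + n}) : R[i] :=
  \sum_(i < N) taylor_coef (g i) (zexp m) * (taylor_coef (g i) (zbarexp m))^*.

(** * Weights, leading polynomial and leftover polynomial *)

Definition wdeg (n : nat) (L : 'I_n -> rat) (m : 'X_{1..n + n}) : rat :=
  \sum_(i < n) (zexp m i + zbarexp m i)%:R * L i.

Definition is_leading (R : realType) (n N : nat) (L : 'I_n -> rat)
    (g : 'I_N -> 'rV[R[i]]_n -> R[i]) (P : {mpoly R[i][n + n]}) : Prop :=
  forall m, P@_m = if wdeg L m == 1 then Fcoef g m else 0.

Definition leftover (R : realType) (n N : nat) (L : 'I_n -> rat)
    (g : 'I_N -> 'rV[R[i]]_n -> R[i]) (m : 'X_{1..n + n}) : R[i] :=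
  if 1 < wdeg L m then Fcoef g m else 0.

Definition occurs (R : realType) (n : nat) (k : 'I_n)
    (P : {mpoly R[i][n + n]}) : bool :=
  has (fun m => 0 < zexp m k + zbarexp m k)%N (msupp P).

Definition nvars (R : realType) (n : nat) (P : {mpoly R[i][n + n]}) : nat :=
  #|[pred k : 'I_n | occurs k P]|.

(** * Homogeneous transformations *)

Definition whomogeneous (R : realType) (n : nat) (L : 'I_n -> rat) (d : rat)
    (p : {mpoly R[i][n]}) : Prop :=
  forall a, a \in msupp p -> \sum_(i < n) (a i)%:R * L i = d.

Definition new_coord (R : realType) (n : nat) (phi : 'I_n -> {mpoly R[i][n]})
  (i : 'I_n) : {mpoly R[i][n]} := 'X_i + phi i.

Definition coord_map (R : realType) (n : nat) (phi : 'I_n -> {mpoly R[i][n]})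
    (z : 'rV[R[i]]_n) : 'rV[R[i]]_n :=
  \row_l (new_coord phi l).@[fun a => z 0 a].

Definition jacobian0 (R : realType) (n : nat)
    (phi : 'I_n -> {mpoly R[i][n]}) : 'M[R[i]]_n :=
  \matrix_(i, l) ((new_coord phi i)^`M(l))@_0%MM.

(* z~_i = z_i + phi_i, with z_(n+1) unchanged; being a change of coordinates at
   the origin is the invertibility of the Jacobian matrix there. *)
Definition homogeneous_transformation (R : realType) (n : nat)
    (L : 'I_n -> rat) (phi : 'I_n -> {mpoly R[i][n]}) : Prop :=
  (forall i, whomogeneous L (L i) (phi i)) /\ jacobian0 phi \in unitmx.

(* p(z), resp. the conjugate of p(z), as a polynomial in z and zbar *)
Definition hol (R : realType) (n : nat) (p : {mpoly R[i][n]}) :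
    {mpoly R[i][n + n]} :=
  p \mPo [tuple ('X_(lshift n i) : {mpoly R[i][n + n]}) | i < n].

Definition antihol (R : realType) (n : nat) (p : {mpoly R[i][n]}) :
    {mpoly R[i][n + n]} :=
  map_mpoly (@Num.conj R[i]) p
    \mPo [tuple ('X_(rshift n i) : {mpoly R[i][n + n]}) | i < n].

(* P' is the expression of P in the coordinates z~ = z + phi, that is
   P'(z~, conj z~) = P(z, conj z). *)
Definition expressed_as (R : realType) (n : nat)
    (phi : 'I_n -> {mpoly R[i][n]}) (P P' : {mpoly R[i][n + n]}) : Prop :=
  P' \mPo [tuple match split i with
                 | inl a => hol (new_coord phi a)
                 | inr a => antihol (new_coord phi a)
                 end | i < n + n] = P.

Definition germs_expressed_as (R : realType) (n N : nat)
    (phi : 'I_n -> {mpoly R[i][n]})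
    (g g' : 'I_N -> 'rV[R[i]]_n -> R[i]) : Prop :=
  forall i, holomorphic_near0 (g' i) /\
    \forall z \near (0 : 'rV[R[i]]_n),
      g' i (coord_map phi z) = g i z.

(** * The Kolar algorithm *)

Definition Bloom_Graham_type (R : realType) (n N : nat)
    (f : 'I_N -> 'rV[R[i]]_n -> R[i]) (m1 : nat) : Prop :=
  (exists2 m, Fcoef f m != 0 & mdeg m = m1) /\
  (forall m, Fcoef f m != 0 -> (m1 <= mdeg m)%N).

(* Below r stands for n - d_t, and indices are counted from 0. *)

Definition in_Theta (R : realType) (n N : nat) (L : 'I_n -> rat)
    (g : 'I_N -> 'rV[R[i]]_n -> R[i]) (r : nat) (m : 'X_{1..n + n}) : Prop :=
  leftover L g m != 0 /\
  \sum_(i < n | (i < r)%N) (zexp m i + zbarexp m i)%:R * L i < 1.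

Definition W (n : nat) (L : 'I_n -> rat) (r : nat) (m : 'X_{1..n + n}) : rat :=
  (1 - \sum_(i < n | (i < r)%N) (zexp m i + zbarexp m i)%:R * L i)
  / (\sum_(i < n | (r <= i)%N) (zexp m i + zbarexp m i))%:R.

Definition is_max_W (R : realType) (n N : nat) (L : 'I_n -> rat)
    (g : 'I_N -> 'rV[R[i]]_n -> R[i]) (r : nat) (mu : rat) : Prop :=
  (exists2 m, in_Theta L g r m & W L r m = mu) /\
  (forall m, in_Theta L g r m -> W L r m <= mu).

(* phi makes P independent of the largest possible number of variables, and
   in the new coordinates the variables of P' are the first ones. *)
Definition optimal_transformation (R : realType) (n : nat) (L : 'I_n -> rat)
    (P : {mpoly R[i][n + n]}) (phi : 'I_n -> {mpoly R[i][n]})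
    (P' : {mpoly R[i][n + n]}) : Prop :=
  [/\ homogeneous_transformation L phi, expressed_as phi P P',
      forall psi P'', homogeneous_transformation L psi ->
        expressed_as psi P P'' -> (nvars P' <= nvars P'')%N &
      forall i : 'I_n, occurs i P' -> (i < nvars P')%N].

(* [Kolar_step f t g L]: a run of the algorithm on sum |f_i|^2 reaches step t
   with weight L, in coordinates where f_i is expressed as g_i. The leading
   polynomial P_t is then given by [is_leading L g], before the transformation
   of step t. *)
Inductive Kolar_step (R : realType) (n N : nat)
    (f : 'I_N -> 'rV[R[i]]_n -> R[i]) :
    nat -> ('I_N -> 'rV[R[i]]_n -> R[i]) -> ('I_n -> rat) -> Prop :=
| Kolar_first (m1 : nat) :
    Bloom_Graham_type f m1 -> Kolar_step f 1 f (fun=> m1%:R^-1)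
| Kolar_next (t : nat) (g g' : 'I_N -> 'rV[R[i]]_n -> R[i]) (L : 'I_n -> rat)
    (P P' : {mpoly R[i][n + n]}) (phi : 'I_n -> {mpoly R[i][n]}) (mu : rat) :
    Kolar_step f t g L -> is_leading L g P ->
    optimal_transformation L P phi P' -> (nvars P' < n)%N ->
    germs_expressed_as phi g g' -> is_max_W L g' (nvars P') mu ->
    Kolar_step f t.+1 g' (fun i => if (i < nvars P')%N then L i else mu).

(** * Levi matrix, dependent rows, allowable transformations *)

Definition Levi_matrix (R : realType) (n : nat) (P : {mpoly R[i][n + n]}) :
    'M[{mpoly R[i][n + n]}]_n :=
  \matrix_(a, b) (P^`M(lshift n a))^`M(rshift n b).

(* A zero row can be dependent in this sense, like the last two rows for
   |z_1|^2 in C^3, although z_k then does not occur in P and there is nothing to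
   eliminate. *)
Definition dependent_row (R : realType) (n : nat)
    (A : 'M[{mpoly R[i][n + n]}]_n) (k : 'I_n) : Prop :=
  exists alpha : 'I_n -> {mpoly R[i][n]},
    row k A = \sum_(l < n | l != k) hol (alpha l) *: row l A /\
    exists2 l, l != k & alpha l != 0.

(* z_k is eliminated, and not merely renamed, if P becomes a polynomial in the
   z~_l with l != k, and z_k itself still completes these to a coordinate
   system. The last condition is the second clause; without it
   z~ = (z_3, z_2 + z_3, z_1) would count as eliminating z_1 from
   |z_1|^2 + |z_2 + z_3|^2. *)
Definition allowable (R : realType) (n : nat) (L : 'I_n -> rat)
    (P : {mpoly R[i][n + n]}) (k : 'I_n) (phi : 'I_n -> {mpoly R[i][n]}) :
    Prop :=
  [/\ homogeneous_transformation L phi,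
      homogeneous_transformation L (fun l => if l == k then 0 else phi l) &
      exists P', [/\ expressed_as phi P P', occurs k P, ~~ occurs k P' &
                     (nvars P' < nvars P)%N]].

(* Main.v *)
(* The weights of the algorithm are positive and the leading polynomial P is
   real, weighted homogeneous and without pure terms.  Because of the latter, a
   combination sum_l v_l R_l of the rows, with v_l holomorphic, vanishes if and
   only if the holomorphic vector field X = sum_l v_l d/dz_l annihilates P.
   If P is a polynomial in coordinates that together with z_k form a coordinate
   system, X is taken to be the corresponding partial derivative in the
   direction of z_k; its coefficients are polynomials because the Jacobian
   determinant, having weight 0, is constant. Conversely, given X P = 0 with
   v_k = 1, the components of v_l of weight lambda_l - lambda_k give a
   locally nilpotent such X, and y_l = sum_m (-z_k)^m / m! X^m z_l is
   annihilated by X and congruent to z_l modulo z_k. Then P and P(y, y_k :=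
   0) are both annihilated by X and congruent modulo z_k, hence equal;
   conjugation does the same for zbar_k. *)
Require Import Defs.
From HB Require Import structures.
From mathcomp Require Import all_boot all_order all_algebra complex.
From mathcomp Require Import perm mpoly ring.
From mathcomp Require Import boolp classical_sets reals constructive_ereal.
From mathcomp Require Import ereal topology normedtype derive.
Set Implicit Arguments.
Unset Strict Implicit.
Unset Printing Implicit Defensive.
Import Order.TTheory GRing.Theory Num.Theory.
Import numFieldNormedType.Exports.
Local Open Scope ring_scope.

(** * Polynomials as the algebra generated by constants and variables *)

Lemma mpoly_alg_ind (n : nat) (R : nzRingType) (K : {mpoly R[n]} -> Prop) :
  (forall c, K c%:MP) -> (forall i, K 'X_i) ->
  (forall p q, K p -> K q -> K (p + q)) ->
  (forall p q, K p -> K q -> K (p * q)) -> forall p, K p.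
Proof.
move=> KC KX KD KM p; rewrite (mpolyE p).
apply: (big_ind K) => [|//|m _]; first by rewrite -mpolyC0.
rewrite -mul_mpolyC; apply: (KM) => //; rewrite mpolyXE_id.
apply: (big_ind K) => [|//|i _]; first by rewrite -mpolyC1.
by elim: (m i) => [|e IHe]; rewrite ?expr0 -?mpolyC1 // exprS; apply: KM.
Qed.

Lemma mpoly_rmorph_ext (n : nat) (R S : nzRingType)
    (f g : {rmorphism {mpoly R[n]} -> S}) :
  (forall c, f c%:MP = g c%:MP) -> (forall i, f 'X_i = g 'X_i) -> f =1 g.
Proof.
move=> fgC fgX; apply: mpoly_alg_ind => // p q fgp fgq.
  by rewrite !rmorphD fgp fgq.
by rewrite !rmorphM fgp fgq.
Qed.

Lemma comp_mpoly_tnth (n m : nat) (R : nzRingType) (t : n.-tuple {mpoly R[m]})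
    (i : 'I_n) :
  'X_i \mPo t = tnth t i.
Proof. by rewrite comp_mpolyXU -tnth_nth. Qed.

(** * Polynomial vector fields *)

Section VectorField.
Variables (n : nat) (R : comNzRingType) (c : 'I_n -> {mpoly R[n]}).
Implicit Types p q : {mpoly R[n]}.

Definition vfield p : {mpoly R[n]} := \sum_(i < n) c i * p^`M(i).

Fact vfield_is_linear : linear vfield.
Proof.
move=> a p q; rewrite /vfield scaler_sumr -big_split /=; apply: eq_bigr => i _.
by rewrite linearP mulrDr scalerAr.
Qed.

HB.instance Definition _ :=
  GRing.isLinear.Build R {mpoly R[n]} {mpoly R[n]} _ vfield vfield_is_linear.

Lemma vfieldM p q : vfield (p * q) = vfield p * q + p * vfield q.
Proof.
rewrite /vfield mulr_suml mulr_sumr -big_split /=; apply: eq_bigr => i _.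
by rewrite mderivM mulrDr !mulrA [p * c i]mulrC.
Qed.

Lemma vfieldC a : vfield a%:MP = 0.
Proof. by rewrite /vfield big1 // => i _; rewrite mderivC mulr0. Qed.

Lemma mderivXU (i j : 'I_n) : ('X_i : {mpoly R[n]})^`M(j) = (i == j)%:R.
Proof.
rewrite mderivX mnm1E; case: eqP => [->|_]; last by rewrite scale0r.
have -> : (U_(j) - U_(j) = 0 :> 'X_{1..n})%MM.
  by apply/mnmP => l; rewrite mnmBE subnn mnm0E.
by rewrite scale1r mpolyX0.
Qed.

Lemma vfieldXU i : vfield 'X_i = c i.
Proof.
rewrite /vfield (bigD1 i) //= mderivXU eqxx mulr1 big1 ?addr0 // => l.
by rewrite mderivXU eq_sym => /negPf ->; rewrite mulr0.
Qed.

Lemma vfield_exp p e : vfield (p ^+ e.+1) = (e.+1%:R * p ^+ e) * vfield p.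
Proof.
elim: e => [|e IHe]; first by rewrite expr1 expr0 !mul1r.
rewrite exprS vfieldM IHe !mulr_natl !mulrnAl mulrnAr mulrA -exprS.
by rewrite [vfield p * _]mulrC -mulrS.
Qed.

End VectorField.

(** The chain rule. Both sides are derivations in [p] along the substitution, so agreement on
    constants and variables suffices. *)
Lemma vfield_comp (m n : nat) (R : comNzRingType) (c : 'I_n -> {mpoly R[n]})
    (t : m.-tuple {mpoly R[n]}) (p : {mpoly R[m]}) :
  vfield c (p \mPo t) = \sum_(i < m) (p^`M(i) \mPo t) * vfield c (tnth t i).
Proof.
elim/mpoly_alg_ind: p => [a|i|p q IHp IHq|p q IHp IHq].
- rewrite comp_mpolyC vfieldC big1 // => i _.
  by rewrite mderivC comp_mpoly0 mul0r.
- rewrite comp_mpoly_tnth (bigD1 i) //= mderivXU eqxx comp_mpoly1 mul1r.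
  rewrite big1 ?addr0 // => l.
  by rewrite mderivXU eq_sym => /negPf ->; rewrite comp_mpoly0 mul0r.
- rewrite comp_mpolyD linearD /= IHp IHq -big_split; apply: eq_bigr => i _ /=.
  by rewrite mderivD comp_mpolyD mulrDl.
rewrite rmorphM vfieldM IHp IHq mulr_suml mulr_sumr -big_split.
apply: eq_bigr => i _ /=.
rewrite mderivM comp_mpolyD !rmorphM mulrDl mulrAC; congr (_ + _).
by rewrite mulrA.
Qed.

(* If [u = x_k^e w] with [e >= 1] maximal, then
   [0 = X u = x_k^(e-1) (e w + x_k X w)], so that [x_k] divides [w]. *)
Lemma vfield_transverse (n : nat) (R : numFieldType)
    (c : 'I_n -> {mpoly R[n]}) (k : 'I_n) (w : {mpoly R[n]}) :
  c k = 1 -> vfield c ('X_k * w) = 0 -> 'X_k * w = 0.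
Proof.
move=> ck Xw0.
have divX e : exists w', 'X_k * w = 'X_k ^+ e.+1 * w'.
  elim: e => [|e [w' def_u]]; first by exists w; rewrite expr1.
  have Xk0 : 'X_k ^+ e != 0 :> {mpoly R[n]}.
    by rewrite expf_neq0 // -msize_poly_eq0 msizeX.
  suff def_w' : w' = 'X_k * - ((e.+1%:R^-1)%:MP * vfield c w').
    by exists (- ((e.+1%:R^-1)%:MP * vfield c w')); rewrite [_ ^+ _.+2]exprSr
      -mulrA -def_w'.
  move: Xw0; rewrite def_u vfieldM vfield_exp vfieldXU ck mulr1.
  rewrite exprSr [_ * 'X_k ^+ e]mulrC -!mulrA -mulrDr => /eqP.
  rewrite mulf_eq0 (negPf Xk0) /= addr_eq0 => /eqP e_w'.
  rewrite mulrN mulrCA -mulrN -e_w' -mpolyC_nat mulrA -mpolyCM mulVf.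
    by rewrite mpolyC1 mul1r.
  by rewrite pnatr_eq0.
(* The power of ['X_k] extracted exceeds the size of the product itself, which is impossible for a
   nonzero polynomial. *)
apply/eqP/negPn/negP => u0.
have [w' def_u] := divX (msize ('X_k * w)).
have w'0 : w' != 0 by apply: contra_neq u0 => w'0; rewrite def_u w'0 mulr0.
have Xe0 : 'X_k ^+ (msize ('X_k * w)).+1 != 0 :> {mpoly R[n]}.
  by rewrite expf_neq0 // -msize_poly_eq0 msizeX.
have := msizeM Xe0 w'0; rewrite -def_u mpolyXn msizeX mdegMn mdeg1 mul1n.
rewrite -msize_poly_eq0 in w'0; case: (msize w') w'0 => // x _.
rewrite addnS /= => /eqP.
by rewrite -addn2 -addnA -[X in X == _]addn0 eqn_add2l.
Qed.

(** The substitution [t] moves [p] by a multiple of ['X_k], and by the chain rule the field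
    annihilates [p \mPo t]. The difference is thus a multiple of ['X_k] in the kernel, so
    [vfield_transverse] makes it zero. *)
Lemma comp_mpoly_vfield_ker (n : nat) (R : numFieldType)
    (c : 'I_n -> {mpoly R[n]}) (k : 'I_n) (t : n.-tuple {mpoly R[n]})
    (p : {mpoly R[n]}) :
  c k = 1 -> (forall i, vfield c (tnth t i) = 0) ->
  (forall i, exists w, tnth t i = 'X_i + 'X_k * w) ->
  vfield c p = 0 -> p \mPo t = p.
Proof.
move=> ck Xt0 t_mod Xp0.
have [w def_w] : exists w, p \mPo t = p + 'X_k * w.
  elim/mpoly_alg_ind: {Xp0} p
      => [a|i|p q [u eq_u] [v eq_v]|p q [u eq_u] [v eq_v]].
  - by exists 0; rewrite comp_mpolyC mulr0 addr0.
  - by have [w def_w] := t_mod i; exists w; rewrite comp_mpoly_tnth.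
  - by exists (u + v); rewrite comp_mpolyD eq_u eq_v mulrDr addrACA.
  exists (u * q + p * v + u * ('X_k * v)); rewrite rmorphM /= eq_u eq_v.
  by ring.
suff: 'X_k * w = 0 by rewrite def_w => ->; rewrite addr0.
apply: (vfield_transverse ck).
have -> : 'X_k * w = (p \mPo t) - p by rewrite def_w addrC addKr.
rewrite linearB /= Xp0 subr0 vfield_comp big1 // => i _.
by rewrite Xt0 mulr0.
Qed.

(** Serves both for the weighted components [wcomp] and for setting variables to 0 in [drop_var]. *)
Definition mfilter (n : nat) (R : nzRingType) (T : pred 'X_{1..n})
    (p : {mpoly R[n]}) : {mpoly R[n]} :=
  \sum_(a <- msupp p | T a) p@_a *: 'X_[a].

Lemma mcoeff_mfilter (n : nat) (R : nzRingType) (T : pred 'X_{1..n})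
    (p : {mpoly R[n]}) a :
  (mfilter T p)@_a = if T a then p@_a else 0.
Proof.
rewrite raddf_sum /=; have [a_p|a_p] := boolP (a \in msupp p).
  case: ifP => Ta; last first.
    rewrite big1 // => b Tb; rewrite mcoeffZ mcoeffX.
    by case: (b =P a) Tb => [->|_]; rewrite ?Ta ?mulr0.
  rewrite big_mkcond (bigD1_seq a) ?msupp_uniq //= Ta mcoeffZ mcoeffX eqxx.
  rewrite mulr1 big1 ?addr0 // => b /negPf ba.
  by rewrite mcoeffZ mcoeffX ba mulr0 if_same.
rewrite (memN_msupp_eq0 a_p) if_same big_seq_cond big1 // => b /andP[b_p _].
rewrite mcoeffZ mcoeffX; case: eqP => [ba|_]; last by rewrite mulr0.
by rewrite -ba b_p in a_p.
Qed.

(** * Weighted homogeneity *)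

Section Weight.
Variables (R : realType) (n : nat) (L : 'I_n -> rat).
Implicit Types (a b : 'X_{1..n}) (d e : rat) (p q : {mpoly R[i][n]}).

Definition mwt a : rat := \sum_(i < n) (a i)%:R * L i.

Lemma mwtD a b : mwt (a + b)%MM = mwt a + mwt b.
Proof.
rewrite /mwt -big_split; apply: eq_bigr => i _ /=.
by rewrite mnmDE natrD mulrDl.
Qed.

Lemma mwt0 : mwt 0%MM = 0.
Proof. by rewrite /mwt big1 // => i _; rewrite mnm0E mul0r. Qed.

Lemma mwtU i : mwt U_(i)%MM = L i.
Proof.
rewrite /mwt (bigD1 i) //= mnm1E eqxx mul1r big1 ?addr0 // => l.
by rewrite mnm1E eq_sym => /negPf ->; rewrite mul0r.
Qed.

Lemma whomogeneousP d p :
  whomogeneous L d p <-> (forall a, p@_a != 0 -> mwt a = d).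
Proof. by split=> hp a; have := hp a; rewrite mcoeff_msupp. Qed.

Lemma whomogeneous0 d : whomogeneous L d (0 : {mpoly R[i][n]}).
Proof. by move=> a; rewrite msupp0. Qed.

Lemma whomogeneousD d p q :
  whomogeneous L d p -> whomogeneous L d q -> whomogeneous L d (p + q).
Proof. by move=> hp hq a /msuppD_le; rewrite mem_cat => /orP[/hp|/hq]. Qed.

Lemma whomogeneousZ d c p : whomogeneous L d p -> whomogeneous L d (c *: p).
Proof. by move=> hp a /msuppZ_le /hp. Qed.

Lemma whomogeneousN d p : whomogeneous L d p -> whomogeneous L d (- p).
Proof. by rewrite -scaleN1r; exact: whomogeneousZ. Qed.

Lemma whomogeneousX a : whomogeneous L (mwt a) ('X_[a] : {mpoly R[i][n]}).
Proof. by move=> b; rewrite msuppX inE => /eqP ->. Qed.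

Lemma whomogeneousXU i : whomogeneous L (L i) ('X_i : {mpoly R[i][n]}).
Proof. by rewrite -{1}mwtU; exact: whomogeneousX. Qed.

Lemma whomogeneousC c : whomogeneous L 0 (c%:MP : {mpoly R[i][n]}).
Proof.
by rewrite -mwt0 -[c%:MP]mulr1 -mpolyX0 mul_mpolyC;
   exact/whomogeneousZ/whomogeneousX.
Qed.

Lemma whomogeneousM d e p q :
  whomogeneous L d p -> whomogeneous L e q -> whomogeneous L (d + e) (p * q).
Proof.
move=> hp hq a /msuppM_le /allpairsP[[a1 a2] /= [/hp a1d /hq a2e ->]].
by rewrite [LHS]mwtD; congr (_ + _).
Qed.

Lemma whomogeneous_exp d p m :
  whomogeneous L d p -> whomogeneous L (m%:R * d) (p ^+ m).
Proof.
move=> hp; elim: m => [|m IHm].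
  by rewrite expr0 mul0r -mpolyC1; exact: whomogeneousC.
by rewrite exprS -nat1r mulrDl mul1r; exact: whomogeneousM.
Qed.

Lemma whomogeneous_sum d (I : Type) (r : seq I) (Q : pred I)
    (F : I -> {mpoly R[i][n]}) :
  (forall i, Q i -> whomogeneous L d (F i)) ->
  whomogeneous L d (\sum_(i <- r | Q i) F i).
Proof.
move=> hF; apply: big_ind => //; first exact: whomogeneous0.
by move=> p q; exact: whomogeneousD.
Qed.

Lemma whomogeneous_prod (I : Type) (r : seq I) (w : I -> rat)
    (F : I -> {mpoly R[i][n]}) :
  (forall i, whomogeneous L (w i) (F i)) ->
  whomogeneous L (\sum_(i <- r) w i) (\prod_(i <- r) F i).
Proof.
move=> hF; elim: r => [|i r IHr].
  by rewrite !big_nil -mpolyC1; exact: whomogeneousC.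
by rewrite !big_cons; exact: whomogeneousM.
Qed.

Lemma whomogeneous_deriv d i p :
  whomogeneous L d p -> whomogeneous L (d - L i) p^`M(i).
Proof.
move=> /whomogeneousP hp; apply/whomogeneousP => a.
rewrite mcoeff_deriv mulrn_eq0 /= => /hp.
by rewrite mwtD mwtU => <-; rewrite addrK.
Qed.

Lemma whomogeneous_vfield d e (c : 'I_n -> {mpoly R[i][n]}) p :
  (forall i, whomogeneous L (L i - e) (c i)) -> whomogeneous L d p ->
  whomogeneous L (d - e) (vfield c p).
Proof.
move=> hc hp; apply: whomogeneous_sum => i _.
have -> : d - e = (L i - e) + (d - L i) by ring.
by apply: whomogeneousM => //; exact: whomogeneous_deriv.
Qed.

Definition wcomp d p : {mpoly R[i][n]} := mfilter (fun a => mwt a == d) p.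

Lemma mcoeff_wcomp d p a : (wcomp d p)@_a = if mwt a == d then p@_a else 0.
Proof. exact: mcoeff_mfilter. Qed.

Fact wcomp_is_linear d : linear (wcomp d).
Proof.
move=> c p q; apply/mpolyP => a; rewrite mcoeffD mcoeffZ !mcoeff_wcomp.
by case: ifP => _; rewrite ?mcoeffD ?mcoeffZ ?mulr0 ?addr0.
Qed.

HB.instance Definition _ d :=
  GRing.isLinear.Build R[i] {mpoly R[i][n]} {mpoly R[i][n]} _ (wcomp d)
    (wcomp_is_linear d).

Lemma wcomp_homogeneous d p : whomogeneous L d (wcomp d p).
Proof.
apply/whomogeneousP => a; rewrite mcoeff_wcomp.
by case: ifP => [/eqP //|_]; rewrite eqxx.
Qed.

Lemma wcomp_id d e p :
  whomogeneous L d p -> wcomp e p = if d == e then p else 0.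
Proof.
move=> /whomogeneousP hp; apply/mpolyP => a; rewrite mcoeff_wcomp.
have [pa0|/hp <-] := eqVneq p@_a 0.
  by rewrite pa0 if_same; case: ifP; rewrite ?mcoeff0 ?pa0.
by case: ifP => // _; rewrite mcoeff0.
Qed.

(** A homogeneous factor shifts all weights by [e]. By linearity only monomials [p] matter, and for
    these each side is the full product or 0. *)
Lemma wcompM d e p q :
  whomogeneous L e q -> wcomp (d + e) (p * q) = wcomp d p * q.
Proof.
move=> hq; rewrite [p]mpolyE mulr_suml !raddf_sum /= mulr_suml.
apply: eq_bigr => a _; rewrite -scalerAl !linearZ /= -scalerAl; congr (_ *: _).
rewrite (wcomp_id _ (whomogeneousM (@whomogeneousX a) hq)).
rewrite (wcomp_id _ (@whomogeneousX a)) (inj_eq (addIr e)).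
by case: ifP => // _; rewrite mul0r.
Qed.

Hypothesis L_gt0 : forall i, 0 < L i.

Lemma mwt_ge0 a : 0 <= mwt a.
Proof. by apply: sumr_ge0 => i _; rewrite mulr_ge0 // ltW. Qed.

Lemma mwt_eq0 a : (mwt a == 0) = (a == 0%MM).
Proof.
apply/eqP/eqP => [a0|->]; last exact: mwt0.
apply/mnmP => i; rewrite mnm0E; apply/eqP.
have /eqP := a0; rewrite psumr_eq0; last by move=> l _; rewrite mulr_ge0 // ltW.
move=> /allP/(_ i); rewrite mem_index_enum => /(_ isT) /=.
by rewrite mulf_eq0 pnatr_eq0 (gt_eqF (L_gt0 i)) orbF.
Qed.

Lemma whomogeneous_lt0 d p : d < 0 -> whomogeneous L d p -> p = 0.
Proof.
move=> d_lt0 /whomogeneousP hp; apply/mpolyP => a; rewrite mcoeff0.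
apply/eqP/negPn/negP => /hp ad.
by have := mwt_ge0 a; rewrite ad leNgt d_lt0.
Qed.

(** With positive weights the only monomial of weight 0 is the constant one. *)
Lemma whomogeneous_eq0 p : whomogeneous L 0 p -> p = (p@_0%MM)%:MP.
Proof.
move=> /whomogeneousP hp; apply/mpolyP => a; rewrite mcoeffC.
have [->|a0] := eqVneq a 0%MM; first by rewrite mulr1.
by rewrite mulr0; apply: contraNeq a0 => /hp /eqP; rewrite mwt_eq0.
Qed.

End Weight.

Lemma whomogeneous_comp (R : realType) (n m : nat) (L : 'I_n -> rat)
    (L' : 'I_m -> rat) (t : n.-tuple {mpoly R[i][m]}) d (p : {mpoly R[i][n]}) :
  (forall i, whomogeneous L' (L i) (tnth t i)) -> whomogeneous L d p ->
  whomogeneous L' d (p \mPo t).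
Proof.
move=> ht hp; rewrite comp_mpolyE big_seq_cond.
apply: whomogeneous_sum => a /andP[/hp <- _]; apply: whomogeneousZ.
by apply: whomogeneous_prod => i; exact: whomogeneous_exp.
Qed.

Lemma mderiv_comp (m n : nat) (R : comNzRingType) (t : m.-tuple {mpoly R[n]})
    (j : 'I_n) (p : {mpoly R[m]}) :
  (p \mPo t)^`M(j) = \sum_(i < m) (p^`M(i) \mPo t) * (tnth t i)^`M(j).
Proof.
(* A partial derivative is a vector field with constant coefficients, so [vfield_comp] applies. *)
have mderivE q : q^`M(j) = vfield (fun i => (i == j)%:R) q.
  rewrite /vfield (bigD1 j) //= eqxx mul1r big1 ?addr0 // => i /negPf ->.
  by rewrite mul0r.
by rewrite mderivE vfield_comp; apply: eq_bigr => i _; rewrite mderivE.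
Qed.

Lemma wcomp_comp (R : realType) (n m : nat) (L : 'I_n -> rat)
    (L' : 'I_m -> rat) (t : n.-tuple {mpoly R[i][m]}) d (p : {mpoly R[i][n]}) :
  (forall i, whomogeneous L' (L i) (tnth t i)) ->
  wcomp L' d (p \mPo t) = wcomp L d p \mPo t.
Proof.
move=> ht; rewrite [p]mpolyE (raddf_sum (wcomp L d)).
rewrite !(raddf_sum (comp_mpoly t)) (raddf_sum (wcomp _ _)).
apply: eq_bigr => a _ /=.
rewrite !linearZ /=; congr (_ *: _).
have ha := @whomogeneousX R n L a.
rewrite (wcomp_id _ (whomogeneous_comp ht ha)) (wcomp_id _ ha).
by case: ifP; rewrite ?comp_mpoly0.
Qed.

(* The Dixmier map of the vector field X, for which x_k is a slice. *)
Lemma vfield_ker_modX (R : realType) (n : nat) (L : 'I_n -> rat)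
    (c : 'I_n -> {mpoly R[i][n]}) (k : 'I_n) (d : rat) (p : {mpoly R[i][n]}) :
  (forall i, 0 < L i) -> c k = 1 ->
  (forall i, whomogeneous L (L i - L k) (c i)) -> whomogeneous L d p ->
  exists y, [/\ vfield c y = 0, whomogeneous L d y &
                exists w, y = p + 'X_k * w].
Proof.
move=> L_gt0 ck hc hp; pose X m := iter m (vfield c) p.
have hX m : whomogeneous L (d - m%:R * L k) (X m).
  elim: m => [|m IHm]; first by rewrite mul0r subr0.
  rewrite -nat1r mulrDl mul1r opprD addrA addrAC.
  exact: whomogeneous_vfield.
have [M XM] : exists M, X M.+1 = 0.
  (* Each application of the field lowers the weight by [L k > 0]; this many steps, plus one, make
     it negative. *)
  exists (Num.truncn (d / L k)); apply: (whomogeneous_lt0 L_gt0 _ (@hX _)).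
  by rewrite subr_lt0 -ltr_pdivrMr ?truncnS_gt.
pose u m : R[i] := (-1) ^+ m / m`!%:R.
have u_rec m : u m.+1 * m.+1%:R = - u m.
  rewrite /u factS natrM invfM [_^-1 * _]mulrC mulrA mulfVK ?pnatr_eq0 //.
  by rewrite exprS mulN1r mulNr.
pose y m := \sum_(i < m) u i *: ('X_k ^+ i * X i).
(* The sum telescopes: differentiating the power of ['X_k] in one term cancels what the previous
   term left over, so only the last term survives. *)
have Xy m : vfield c (y m.+1) = u m *: ('X_k ^+ m * X m.+1).
  elim: m => [|m IHm].
    by rewrite /y big_ord1 linearZ /= !expr0 !mul1r.
  rewrite /y big_ord_recr linearD /= -/(y m.+1) IHm linearZ /= vfieldM.
  rewrite vfield_exp vfieldXU ck mulr1 scalerDr addrA -[RHS]add0r.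
  congr (_ + _); rewrite -mulrA -mpolyC_nat mul_mpolyC scalerA u_rec scaleNr.
  exact: subrr.
exists (y M.+1); split; first by rewrite Xy XM mulr0 scaler0.
  apply: whomogeneous_sum => i _; apply: whomogeneousZ.
  rewrite -[d](subrK (i%:R * L k)) addrC; apply: whomogeneousM => //.
  exact/whomogeneous_exp/whomogeneousXU.
exists (\sum_(i < M) u i.+1 *: ('X_k ^+ i * X i.+1)).
rewrite /y big_ord_recl /u expr0 divr1 scale1r expr0 mul1r mulr_sumr.
by congr (_ + _); apply: eq_bigr => i _; rewrite -scalerAr mulrA -exprS.
Qed.

(** * Polynomials in [z] and [zbar] *)

Section Double.
Variables (R : realType) (n : nat).
Implicit Types (L : 'I_n -> rat) (p : {mpoly R[i][n]}).
Implicit Types (P Q : {mpoly R[i][n + n]}) (m : 'X_{1..n + n}).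

(** Giving [z_a] and its conjugate the same weight turns [wdeg] into an instance of [mwt], so the
    theory above applies in [n + n] variables. *)
Definition dweight L (i : 'I_(n + n)) : rat :=
  match split i with inl a => L a | inr a => L a end.

Lemma split_lshift (a : 'I_n) : split (lshift n a) = inl a.
Proof. exact: (unsplitK (inl a)). Qed.

Lemma split_rshift (a : 'I_n) : split (rshift n a) = inr a.
Proof. exact: (unsplitK (inr a)). Qed.

Lemma double_ind (K : 'I_(n + n) -> Prop) :
  (forall a, K (lshift n a)) -> (forall a, K (rshift n a)) -> forall i, K i.
Proof. by move=> Kl Kr i; rewrite -(splitK i); case: (split i). Qed.

Lemma wdegE L m : wdeg L m = mwt (dweight L) m.
Proof.
rewrite /mwt big_split_ord /= -big_split; apply: eq_bigr => a _ /=.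
by rewrite /dweight split_lshift split_rshift !mnmE natrD mulrDl.
Qed.

Lemma holXU (a : 'I_n) : hol ('X_a : {mpoly R[i][n]}) = 'X_(lshift n a).
Proof. by rewrite /hol comp_mpoly_tnth tnth_mktuple. Qed.

Lemma wcomp_hol L d p : wcomp (dweight L) d (hol p) = hol (wcomp L d p).
Proof.
apply: wcomp_comp => a; rewrite tnth_mktuple.
have -> : L a = dweight L (lshift n a) by rewrite /dweight split_lshift.
exact: whomogeneousXU.
Qed.

Lemma mderiv_hol_l p (a : 'I_n) : (hol p)^`M(lshift n a) = hol p^`M(a).
Proof.
rewrite /hol mderiv_comp (bigD1 a) //= tnth_mktuple mderivXU eqxx mulr1n.
rewrite [X in X + _]mulr1.
rewrite big1 ?addr0 // => b; rewrite tnth_mktuple mderivXU.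
by rewrite (inj_eq (@lshift_inj _ _)) => /negPf ->; rewrite mulr0.
Qed.

Lemma mderiv_hol_r p (b : 'I_n) : (hol p)^`M(rshift n b) = 0.
Proof.
rewrite /hol mderiv_comp big1 // => a _; rewrite tnth_mktuple mderivXU.
by rewrite eq_lrshift mulr0.
Qed.

Lemma mderiv_antihol_l p (a : 'I_n) : (antihol p)^`M(lshift n a) = 0.
Proof.
rewrite /antihol mderiv_comp big1 // => b _; rewrite tnth_mktuple mderivXU.
by rewrite eq_rlshift mulr0.
Qed.

(** The field of type (1,0) with holomorphic coefficients [v]; it treats the conjugate variables as
    constants. *)
Definition holfield (v : 'I_n -> {mpoly R[i][n]}) (i : 'I_(n + n)) :
    {mpoly R[i][n + n]} :=
  match split i with inl a => hol (v a) | inr _ => 0 end.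

Lemma vfield_holfieldE v P :
  vfield (holfield v) P = \sum_(a < n) hol (v a) * P^`M(lshift n a).
Proof.
rewrite /vfield big_split_ord /= [X in _ + X]big1 ?addr0.
  by apply: eq_bigr => a _; rewrite /holfield split_lshift.
by move=> a _; rewrite /holfield split_rshift mul0r.
Qed.

Lemma vfield_hol v p : vfield (holfield v) (hol p) = hol (vfield v p).
Proof.
rewrite vfield_holfieldE /hol raddf_sum; apply: eq_bigr => a _ /=.
by rewrite -/(hol _) mderiv_hol_l rmorphM.
Qed.

Lemma vfield_antihol v p : vfield (holfield v) (antihol p) = 0.
Proof.
by rewrite vfield_holfieldE big1 // => a _; rewrite mderiv_antihol_l mulr0.
Qed.

(** Holomorphic coefficients pass through the derivative in [zbar_b]. The right side is entry [b] of
    the combination of Levi rows of [P] with coefficients [v]. *)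
Lemma mderiv_holfield_r v P (b : 'I_n) :
  (vfield (holfield v) P)^`M(rshift n b) =
  \sum_(a < n) hol (v a) * P^`M(lshift n a)^`M(rshift n b).
Proof.
rewrite vfield_holfieldE raddf_sum; apply: eq_bigr => a _ /=.
by rewrite mderivM mderiv_hol_r mul0r add0r.
Qed.

(** One-sided on purpose: only monomials in [z] alone, the constant included, are excluded. This
    survives derivatives in [z_a] and multiplication by any polynomial, whereas a derivative in
    [z_a] can create pure terms in [zbar]. *)
Definition no_pure P : Prop := forall m, zbarexp m = 0%MM -> P@_m = 0.

Lemma no_pure_deriv P (a : 'I_n) : no_pure P -> no_pure P^`M(lshift n a).
Proof.
move=> nP m m0; rewrite mcoeff_deriv nP ?mul0rn //.
apply/mnmP => b; have /mnmP/(_ b) := m0.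
by rewrite !mnmE eq_lrshift addn0.
Qed.

Lemma no_pureM P Q : no_pure Q -> no_pure (P * Q).
Proof.
move=> nQ m m0; rewrite mcoeffM big1 // => -[a b] /= /eqP def_m.
rewrite nQ ?mulr0 //; apply/mnmP => i; move/mnmP/(_ i): m0.
have := congr1 (fun x : 'X_{1..n + n} => x (rshift n i)) def_m.
rewrite mnmDE !mnmE => -> /eqP.
by rewrite addn_eq0 => /andP[_ /eqP].
Qed.

Lemma no_pure_sum (I : Type) (r : seq I) (F : I -> {mpoly R[i][n + n]}) :
  (forall i, no_pure (F i)) -> no_pure (\sum_(i <- r) F i).
Proof. by move=> nF m m0; rewrite raddf_sum big1 // => i _ /=; exact: nF. Qed.

Lemma mderiv_eq0_coef (j : 'I_(n + n)) P m :
  P^`M(j) = 0 -> (0 < m j)%N -> P@_m = 0.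
Proof.
move=> P0 mj; have := mcoeff_deriv j (m - U_(j))%MM P.
rewrite P0 mcoeff0 submK ?lep1mP -?lt0n // => /esym/eqP.
by rewrite mulrn_eq0 => /eqP.
Qed.

(** Vanishing [zbar] derivatives leave only monomials in [z] alone, and these are excluded. *)
Lemma no_pure_eq0 P :
  no_pure P -> (forall b : 'I_n, P^`M(rshift n b) = 0) -> P = 0.
Proof.
move=> nP dP; apply/mpolyP => m; rewrite mcoeff0.
have [b mb|m0] := pickP (fun b => zbarexp m b != 0)%N.
  by apply: (mderiv_eq0_coef (dP b)); rewrite lt0n; rewrite mnmE in mb.
by apply: nP; apply/mnmP => b; have /negbFE/eqP := m0 b; rewrite mnm0E.
Qed.

(** * Complex conjugation of polynomials in [z] and [zbar] *)

Definition swap (i : 'I_(n + n)) : 'I_(n + n) :=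
  match split i with inl a => rshift n a | inr a => lshift n a end.

Lemma swapK : involutive swap.
Proof.
by apply: double_ind => a; rewrite /swap ?(split_lshift, split_rshift).
Qed.

Definition swap_perm : 'S_(n + n) := perm (can_inj swapK).

(** Conjugation of the function [P(z, zbar)]: coefficients are conjugated and [z], [zbar] exchanged.
    Its fixed points are the real-valued polynomials. *)
Definition conj_swap : {mpoly R[i][n + n]} -> {mpoly R[i][n + n]} :=
  msym swap_perm \o map_mpoly (@Num.conj R[i]).

HB.instance Definition _ := GRing.RMorphism.on conj_swap.
End Double.

Section ConjSwap.
Variables (R : realType) (n : nat).
Implicit Types (L : 'I_n -> rat) (p : {mpoly R[i][n]}).
Implicit Types (P Q : {mpoly R[i][n + n]}) (m : 'X_{1..n + n}).

Lemma conj_swapC (c : R[i]) :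
  conj_swap (c%:MP : {mpoly R[i][n + n]}) = (c^*)%:MP.
Proof. by rewrite /conj_swap /= map_mpolyC /msym mmapC. Qed.

Lemma conj_swapXU i : conj_swap ('X_i : {mpoly R[i][n + n]}) = 'X_(swap i).
Proof.
by rewrite /conj_swap /= map_mpolyX /msym mmapX mmap1U permE.
Qed.

Definition mswap m : 'X_{1..n + n} := [multinom m (swap i) | i < n + n].

Lemma mcoeff_conj_swap P m : (conj_swap P)@_m = (P@_(mswap m))^*.
Proof.
rewrite /conj_swap /= mcoeff_sym mcoeff_map_mpoly; congr (_ _@__).
by apply/mnmP => i; rewrite !mnmE permE.
Qed.

Lemma swap_lshift (a : 'I_n) : swap (lshift n a) = rshift n a.
Proof. by rewrite /swap split_lshift. Qed.

Lemma swap_rshift (a : 'I_n) : swap (rshift n a) = lshift n a.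
Proof. by rewrite /swap split_rshift. Qed.

Lemma zexp_mswap m : zexp (mswap m) = zbarexp m.
Proof. by apply/mnmP => i; rewrite !mnmE swap_lshift. Qed.

Lemma zbarexp_mswap m : zbarexp (mswap m) = zexp m.
Proof. by apply/mnmP => i; rewrite !mnmE swap_rshift. Qed.

Lemma wdeg_mswap L m : wdeg L (mswap m) = wdeg L m.
Proof.
by rewrite /wdeg zexp_mswap zbarexp_mswap; under eq_bigr do rewrite addnC.
Qed.

Lemma antiholXU (a : 'I_n) : antihol ('X_a : {mpoly R[i][n]}) = 'X_(rshift n a).
Proof. by rewrite /antihol map_mpolyX comp_mpoly_tnth tnth_mktuple. Qed.

HB.instance Definition _ := GRing.RMorphism.copy (@hol R n)
  (comp_mpoly [tuple ('X_(lshift n i) : {mpoly R[i][n + n]}) | i < n]).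
HB.instance Definition _ := GRing.RMorphism.copy (@antihol R n)
  (comp_mpoly [tuple ('X_(rshift n i) : {mpoly R[i][n + n]}) | i < n]
     \o map_mpoly (@Num.conj R[i])).

Lemma conj_swap_hol p : conj_swap (hol p) = antihol p.
Proof.
apply: (@mpoly_rmorph_ext _ _ _ (@conj_swap R n \o @hol R n) (@antihol R n)).
  by move=> c; rewrite /= /hol /antihol map_mpolyC !comp_mpolyC conj_swapC.
by move=> a; rewrite /= holXU antiholXU conj_swapXU swap_lshift.
Qed.

Lemma conj_swapK : involutive (@conj_swap R n).
Proof.
apply: (@mpoly_rmorph_ext _ _ _ (@conj_swap R n \o @conj_swap R n) idfun).
  by move=> c; rewrite /= !conj_swapC conjCK.
by move=> i; rewrite /= !conj_swapXU swapK.
Qed.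

Lemma conj_swap_antihol p : conj_swap (antihol p) = hol p.
Proof. by rewrite -conj_swap_hol conj_swapK. Qed.

(** * Leading polynomials and weights along the algorithm *)

Record leading_like L P : Prop := LeadingLike {
  leading_hermitian : conj_swap P = P;
  leading_no_pure : no_pure P;
  leading_homogeneous : whomogeneous (dweight L) 1 P }.

Lemma Fcoef_mswap N (g : 'I_N -> 'rV[R[i]]_n -> R[i]) m :
  Fcoef g (mswap m) = (Fcoef g m)^*.
Proof.
rewrite /Fcoef rmorph_sum; apply: eq_bigr => i _ /=.
rewrite zexp_mswap zbarexp_mswap.
by move: (taylor_coef _ _) (taylor_coef _ _) => x y;
   rewrite rmorphM /= conjCK mulrC.
Qed.

Lemma taylor_coef0 (h : 'rV[R[i]]_n -> R[i]) : taylor_coef h 0%MM = h 0.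
Proof.
rewrite /taylor_coef big1 ?divr1; last by move=> i _; rewrite mnm0E.
by rewrite /mpartial; elim: (enum 'I_n) => //= i s IHs; rewrite mnm0E.
Qed.

(** The coefficients of a sum of squares are Hermitian, and each summand of the coefficient of a
    term in [z] alone has the factor [g_i(0)^* = 0]. *)
Lemma leadingP L N (g : 'I_N -> 'rV[R[i]]_n -> R[i]) P :
  (forall i, g i 0 = 0) -> is_leading L g P -> leading_like L P.
Proof.
move=> g0 PE; split.
- apply/mpolyP => m; rewrite mcoeff_conj_swap !PE wdeg_mswap Fcoef_mswap.
  by case: ifP; rewrite ?conjCK ?conjC0.
- move=> m m0; rewrite PE /Fcoef big1 ?if_same // => i _.
  by rewrite m0 taylor_coef0 g0 conjC0 mulr0.
by apply/whomogeneousP => m; rewrite PE -wdegE; case: ifP => [/eqP //|];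
   rewrite eqxx.
Qed.

Lemma Kolar_stepP N (f g : 'I_N -> 'rV[R[i]]_n -> R[i]) t L :
  (forall i, f i 0 = 0) -> Kolar_step f t g L ->
  (forall i, g i 0 = 0) /\ (forall i, 0 < L i).
Proof.
move=> f0; elim=> {t g L}
  [m1 [[m Fm m_m1] _]|t g g' L P P' phi mu _ [g0 L_gt0]].
  (* The type [m1] is positive because the constant coefficient of F vanishes with the [f_i]. *)
  split=> // i; rewrite invr_gt0 ltr0n lt0n -m_m1; apply: contraNN Fm.
  rewrite mdeg_eq0 => /eqP ->; rewrite /Fcoef big1 // => l _.
  have -> : zexp (0 : 'X_{1..n + n}) = 0%MM by apply/mnmP => a; rewrite !mnmE.
  by rewrite taylor_coef0 f0 mul0r.
move=> _ [[phi_hom _] _ _ _] _ g_g' [[m [m_left m_Theta] <-] _]; split=> i.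
  (* The relation between [g] and [g'] is read at the origin, which [coord_map phi] fixes: the
     monomials of [phi l] have weight [L l > 0], so none is constant. *)
  have [_ /nbhs_singleton] := g_g' i; rewrite g0; congr (g' i _ = 0).
  apply/rowP => l; rewrite !mxE /new_coord mevalD mevalXU mxE add0r.
  rewrite mevalE big_seq_cond big1 // => a /andP[/(phi_hom l) al _].
  have [a0|/existsP[b ab]] := altP (@forallP _ (fun b : 'I_n => a b == 0%N)).
    by move: (L_gt0 l); rewrite -al big1 ?ltxx // => b _;
      rewrite (eqP (a0 b)) mul0r.
  by rewrite (bigD1 b) //= mxE expr0n (negPf ab) mul0r mulr0.
case: ifP => // _; rewrite /W divr_gt0 ?subr_gt0 //.
(* If the denominator of [W] were 0, only the first variables would occur in [m], so its full weight
   would be below 1 and [m] could not be a leftover term. *)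
rewrite ltr0n lt0n; apply: contraNneq m_left => m0.
rewrite /leftover; case: ifP => //; rewrite ltNge => /negP[].
apply: le_trans (ltW m_Theta).
rewrite /wdeg [leRHS]big_mkcond ler_sum // => a _; case: ifP => //.
move=> /negbT; rewrite -leqNgt => ra; move/eqP: m0.
by rewrite sum_nat_eq0 => /forallP/(_ a); rewrite ra => /= /eqP ->;
   rewrite mul0r.
Qed.

End ConjSwap.

(** * Rows of the Levi matrix *)

Section LeviRows.
Variables (R : realType) (n : nat) (L : 'I_n -> rat).
Variables (P : {mpoly R[i][n + n]}) (k : 'I_n).
Hypotheses (L_gt0 : forall i, 0 < L i) (P_leading : leading_like L P).

Lemma occursP (Q : {mpoly R[i][n + n]}) (l : 'I_n) :
  reflect (exists2 m, Q@_m != 0 & (0 < m (lshift n l) + m (rshift n l))%N)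
          (occurs l Q).
Proof.
by apply: (iffP hasP) => -[m mQ ml]; exists m; move: mQ ml;
   rewrite ?mcoeff_msupp ?mnmE.
Qed.

(** If [z_k] occurs only through its conjugate in some monomial, Hermitian symmetry supplies the
    mirrored monomial containing [z_k]. *)
Lemma occurs_hol_deriv : occurs k P -> P^`M(lshift n k) != 0.
Proof.
case/occursP => m Pm m_k; apply/eqP => dP.
suff [m' Pm' m'_k] : exists2 m', P@_m' != 0 & (0 < m' (lshift n k))%N.
  by rewrite (mderiv_eq0_coef dP m'_k) eqxx in Pm'.
have [m_l|m_l] := ltnP 0 (m (lshift n k)); first by exists m.
exists (mswap m).
  by rewrite -(leading_hermitian P_leading) mcoeff_conj_swap conjC_eq0 in Pm.
by rewrite mnmE swap_lshift; move: m_k; rewrite leqn0 in m_l; rewrite (eqP m_l).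
Qed.

(** Entry [b] of the combination of rows is the [zbar_b] derivative of [X P]. As [X P] inherits the
    absence of pure terms, it is zero once all these derivatives are. *)
Lemma levi_kernelP (v : 'I_n -> {mpoly R[i][n]}) :
  vfield (holfield v) P = 0 <->
  \sum_(a < n) hol (v a) *: row a (Levi_matrix P) = 0.
Proof.
have rowE b : (\sum_(a < n) hol (v a) *: row a (Levi_matrix P)) 0 b =
    (vfield (holfield v) P)^`M(rshift n b).
  rewrite mderiv_holfield_r summxE; apply: eq_bigr => a _.
  by rewrite !mxE.
split=> [v0|/rowP v0]; first by apply/rowP => b; rewrite rowE v0 mderiv0 mxE.
apply: no_pure_eq0 => [|b]; last by rewrite -rowE v0 mxE.
rewrite vfield_holfieldE; apply: no_pure_sum => a.
exact/no_pureM/no_pure_deriv/(leading_no_pure P_leading).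
Qed.

(** Entry [(i, l)] has weight [L i - L l], so every term of the Leibniz expansion has weight 0. The
    determinant is therefore constant, equal to its nonzero value at the origin. *)
Lemma jacobian_det (phi : 'I_n -> {mpoly R[i][n]}) :
  homogeneous_transformation L phi ->
  exists2 d, d != 0 &
    \det (\matrix_(i, l) (new_coord phi i)^`M(l)) = d%:MP.
Proof.
move=> [phi_hom]; set J := (X in \det X); rewrite unitmxE unitfE => J0.
exists (\det (jacobian0 phi)) => //.
rewrite [LHS](@whomogeneous_eq0 _ _ L) //.
  congr (_%:MP); rewrite -det_map_mx; congr (\det _).
  by apply/matrixP => i l; rewrite !mxE.
rewrite /determinant; apply: whomogeneous_sum => s _.
have hs : whomogeneous L 0 (\prod_i J i (s i)).
  have -> : 0 = \sum_i (L i - L (s i)).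
    by rewrite sumrB [X in X - _](reindex_inj (@perm_inj _ s)) subrr.
  apply: whomogeneous_prod => i; rewrite mxE; apply: whomogeneous_deriv.
  by apply: whomogeneousD => //; exact: whomogeneousXU.
by rewrite mulr_sign; case: (odd_perm s) => //; exact: whomogeneousN.
Qed.

Lemma allowable_dependent_row (phi : 'I_n -> {mpoly R[i][n]}) :
  allowable L P k phi -> dependent_row (Levi_matrix P) k.
Proof.
case=> _ psi_hom [P' [P_expr P_k P'_k _]].
set psi := fun l => _ in psi_hom.
have [d d0 detJ] := jacobian_det psi_hom; set J := \matrix_(i, l) _ in detJ.
(* Column [k] of the adjugate: in the coordinates given by [psi], this field is [d] times the
   partial derivative in the direction of [z_k]. *)
pose v a := (\adj J) a k.
have Xpsi l : vfield v (new_coord psi l) = d%:MP *+ (l == k).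
  have /matrixP/(_ l k) := mul_mx_adj J; rewrite detJ !mxE => <-.
  by apply: eq_bigr => a _; rewrite mxE mulrC.
have vk : v k = d%:MP.
  have := Xpsi k; rewrite eqxx /new_coord /psi eqxx addr0 vfieldXU.
  by move=> ->.
have XP : vfield (holfield v) P = 0.
  rewrite -P_expr vfield_comp big1 // => i _; rewrite tnth_mktuple.
  elim/double_ind: i => l; rewrite ?(split_lshift, split_rshift); last first.
    by rewrite vfield_antihol mulr0.
  (* For [l = k] the outer derivative vanishes since [z_k] does not occur in [P']; for other [l] the
     field annihilates the new coordinate. *)
  have [->|lk] := eqVneq l k.
    rewrite (_ : P'^`M(_) = 0) ?comp_mpoly0 ?mul0r //.
    apply/mpolyP => m; rewrite mcoeff_deriv mcoeff0.
    apply/eqP; rewrite mulrn_eq0 /=; apply: contraNT P'_k => P'_m.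
    apply/occursP; exists (m + U_(lshift n k))%MM => //.
    by rewrite mnmDE mnm1E eqxx addn1.
  have -> : new_coord phi l = new_coord psi l.
    by rewrite /new_coord /psi (negPf lk).
  by rewrite vfield_hol Xpsi (negPf lk) /hol comp_mpoly0 mulr0.
have /levi_kernelP := XP; rewrite (bigD1 k) //= vk => rows0.
have holC (c : R[i]) : hol (c%:MP : {mpoly R[i][n]}) = c%:MP.
  by rewrite /hol comp_mpolyC.
have row_k : row k (Levi_matrix P) =
    \sum_(l < n | l != k) hol (- d^-1 *: v l) *: row l (Levi_matrix P).
  rewrite holC in rows0; move/eqP: rows0; rewrite addr_eq0 => /eqP rows0.
  have -> : row k (Levi_matrix P) =
      (d^-1)%:MP *: (d%:MP *: row k (Levi_matrix P)).
    by rewrite scalerA -mpolyCM mulVf // mpolyC1 scale1r.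
  rewrite rows0 scalerN -scaleNr scaler_sumr; apply: eq_bigr => l _.
  by rewrite scalerA /hol linearZ /= -mul_mpolyC mpolyCN.
exists (fun l => - d^-1 *: v l); split=> //.
(* If all coefficients vanished, row [k] would be zero. Then the [z_k] derivative of [P], free of
   pure terms, would vanish although [z_k] occurs in [P]. *)
have [l lk|v0] := pickP (fun l => (l != k) && (- d^-1 *: v l != 0)).
  by exists l; case/andP: lk.
have := occurs_hol_deriv P_k; case/eqP.
apply: no_pure_eq0 => [|b].
  exact/no_pure_deriv/(leading_no_pure P_leading).
have := congr1 (fun r : 'rV_n => r 0 b) row_k; rewrite !mxE => ->.
rewrite summxE big1 // => l lk.
have := v0 l; rewrite lk => /negbFE/eqP ->.
by rewrite /hol comp_mpoly0 scale0r mxE.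
Qed.

End LeviRows.

(** * Elimination of a variable *)

Section Elimination.
Variables (R : realType) (n : nat) (L : 'I_n -> rat).
Variables (P : {mpoly R[i][n + n]}) (k : 'I_n).
Hypotheses (L_gt0 : forall i, 0 < L i) (P_leading : leading_like L P).

(** [P] with [z_k] and [zbar_k] set to 0, written as a selection of monomials so that the remaining
    variables are visible. *)
Definition drop_var : {mpoly R[i][n + n]} :=
  mfilter (fun m => (m (lshift n k) == 0%N) && (m (rshift n k) == 0%N)) P.

Lemma occurs_drop_var l : occurs l drop_var -> occurs l P && (l != k).
Proof.
case/occursP => m; rewrite mcoeff_mfilter; case: ifP; last by rewrite eqxx.
move=> /andP[/eqP ml /eqP mr] Pm m_l; apply/andP; split.
  by apply/occursP; exists m.
by apply: contraTneq m_l => ->; rewrite ml mr.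
Qed.

Lemma nvars_drop_var : occurs k P -> (nvars drop_var < nvars P)%N.
Proof.
move=> P_k; apply: proper_card; apply/properP; split.
  by apply/fintype.subsetP => l; rewrite !inE => /occurs_drop_var /andP[].
exists k; rewrite !inE //.
by apply/negP => /occurs_drop_var; rewrite eqxx andbF.
Qed.

Lemma drop_var_comp m (t t' : (n + n).-tuple {mpoly R[i][m]}) :
  tnth t' (lshift n k) = 0 -> tnth t' (rshift n k) = 0 ->
  (forall l, l != k -> tnth t' (lshift n l) = tnth t (lshift n l)) ->
  (forall l, l != k -> tnth t' (rshift n l) = tnth t (rshift n l)) ->
  drop_var \mPo t = P \mPo t'.
Proof.
move=> tl0 tr0 tl tr; rewrite [P \mPo _]comp_mpolyE (raddf_sum (comp_mpoly t)).
rewrite big_mkcond /=; apply: eq_bigr => a _; rewrite !big_split_ord /=.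
case: ifP => [/andP[/eqP al /eqP ar]|/nandP ak].
  rewrite [LHS]linearZ /= comp_mpolyX big_split_ord /=.
  congr (_ *: _); congr (_ * _).
    apply: eq_bigr => l _; have [->|/tl -> //] := eqVneq l k.
    by rewrite al !expr0.
  apply: eq_bigr => l _; have [->|/tr -> //] := eqVneq l k.
  by rewrite ar !expr0.
case: ak => [al|ar].
  by rewrite [X in X * _](bigD1 k) //= tl0 expr0n (negPf al) !mul0r scaler0.
by rewrite [X in _ * X](bigD1 k) //= tr0 expr0n (negPf ar) !mul0r mulr0 scaler0.
Qed.

Lemma jacobian_unit (phi : 'I_n -> {mpoly R[i][n]}) :
  phi k = 0 -> (forall l, exists w, phi l = 'X_k * w) ->
  jacobian0 phi \in unitmx.
Proof.
move=> phik phiX.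
have /fin_all_exists [w phiE] := phiX.
(* The Jacobian is a rank-one perturbation [1 + nu e]. Since [e nu = nu_k = 0], its inverse is
   [1 - nu e]. *)
pose nu : 'cV_n := \col_i if i == k then 0 else (w i)@_0%MM.
pose e : 'rV[R[i]]_n := delta_mx 0 k.
have -> : jacobian0 phi = 1%:M + nu *m e.
  apply/matrixP => i l; rewrite !mxE big_ord1 !mxE eqxx /= /new_coord.
  rewrite mderivD mcoeffD mderivXU -mpolyC_nat mcoeffC eqxx mulr1.
  congr (_ + _); have [->|ik] := eqVneq i k.
    by rewrite phik mderiv0 mcoeff0 mul0r.
  rewrite phiE mderivM mderivXU rmorphD !rmorphM /= -mpolyC_nat mcoeffC eqxx.
  rewrite mulr1 mcoeffX -mdeg_eq0 mdeg1 mul0r addr0 mulrC.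
  by rewrite [l == k]eq_sym.
apply: (proj1 (mulmx1_unit (B := 1%:M - nu *m e) _)).
rewrite mulmxDl mul1mx mulmxBr mulmx1 -[_ *m (nu *m e)]mulmxA.
suff -> : e *m (nu *m e) = 0 by rewrite mulmx0 subr0 subrK.
rewrite mulmxA; suff -> : e *m nu = 0 by rewrite mul0mx.
by apply/matrixP => i j; rewrite -rowE !mxE eqxx.
Qed.

Lemma dependent_row_allowable :
  occurs k P -> dependent_row (Levi_matrix P) k ->
  exists phi : 'I_n -> {mpoly R[i][n]}, allowable L P k phi.
Proof.
move=> P_k [alpha [row_k _]].
(* The row relation, with all terms on one side, is a field in the kernel normalised by
   [v k = 1]. *)
pose v l := if l == k then 1 else - alpha l.
have hol1 : hol (1 : {mpoly R[i][n]}) = 1 by exact: comp_mpoly1.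
have XP : vfield (holfield v) P = 0.
  apply/(levi_kernelP P_leading); rewrite (bigD1 k) //= /v eqxx.
  rewrite hol1 scale1r row_k.
  apply/eqP; rewrite addr_eq0 -sumrN; apply/eqP/eq_bigr => l /negPf lk.
  by rewrite lk /hol comp_mpolyN scaleNr opprK.
rewrite vfield_holfieldE in XP.
(* Passing to these components keeps coefficient 1 at [k] and gives the weights needed for
   homogeneous [y l]. The field still annihilates [P]: this is the part of weight [1 - L k] of the
   relation [XP]. *)
pose w l := wcomp L (L l - L k) (v l).
have w_hom l : whomogeneous L (L l - L k) (w l) by exact: wcomp_homogeneous.
have wk : w k = 1.
  rewrite /w /v eqxx subrr -mpolyC1 (wcomp_id _ (@whomogeneousC _ _ L 1)).
  by rewrite eqxx.
have XwP : vfield (holfield w) P = 0.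
  transitivity (wcomp (dweight L) (1 - L k)
      (\sum_(a < n) hol (v a) * P^`M(lshift n a))); last by rewrite XP linear0.
  rewrite vfield_holfieldE (raddf_sum (wcomp _ _)).
  apply: eq_bigr => a _ /=.
  rewrite -wcomp_hol.
  have -> : 1 - L k = (L a - L k) + (1 - L a) by ring.
  rewrite wcompM //; have := leading_homogeneous P_leading.
  move/(@whomogeneous_deriv _ _ _ _ (lshift n a)).
  by rewrite /dweight split_lshift.
have /fin_all_exists [y hy] l : exists y, [/\ vfield w y = 0,
    whomogeneous L (L l) y & exists u, y = 'X_l + 'X_k * u].
  by apply: vfield_ker_modX => //; exact: whomogeneousXU.
(* Only the holomorphic variables are replaced. All entries are annihilated by the field (the
   conjugate variables trivially) and congruent to the variables modulo [z_k]. *)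
pose S0 := [tuple match split i with
                  | inl a => if a == k then 0 else hol (y a)
                  | inr a => 'X_(rshift n a) end | i < n + n].
have S0P : P \mPo S0 = P.
  apply: (comp_mpoly_vfield_ker (k := lshift n k) _ _ _ XwP).
  - by rewrite /holfield split_lshift wk hol1.
  - move=> i; rewrite tnth_mktuple.
    elim/double_ind: i => a; rewrite ?(split_lshift, split_rshift).
      case: eqP => _; first exact: linear0.
      by rewrite vfield_hol; have [-> _ _] := hy a; exact: comp_mpoly0.
    by rewrite vfieldXU /holfield split_rshift.
  move=> i; rewrite tnth_mktuple.
  elim/double_ind: i => a; rewrite ?(split_lshift, split_rshift).
    case: eqP => [->|_]; first by exists (- 1); rewrite mulrN1 subrr.
    have [_ _ [u ->]] := hy a; exists (hol u).
    by rewrite rmorphD rmorphM /= !holXU.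
  by exists 0; rewrite mulr0 addr0.
(* The new coordinates are [y l] for [l != k], together with [z_k] itself. *)
pose phi l := if l == k then 0 else y l - 'X_l.
have phi_new l : l != k -> new_coord phi l = y l.
  by move=> /negPf lk; rewrite /new_coord /phi lk addrC subrK.
have phiX l : exists u, phi l = 'X_k * u.
  rewrite /phi; case: eqP => _; first by exists 0; rewrite mulr0.
  by have [_ _ [u ->]] := hy l; exists u; rewrite addrC addKr.
have phi_transf : homogeneous_transformation L phi.
  split=> [l|]; last by apply: jacobian_unit => //; rewrite /phi eqxx.
  rewrite /phi; case: eqP => _; first exact: whomogeneous0.
  have [_ y_hom _] := hy l; apply: whomogeneousD => //.
  exact/whomogeneousN/whomogeneousXU.
exists phi; split; first exact: phi_transf.
  (* As [phi k = 0] already, the completion by [z_k] required by [allowable] is [phi] itself. *)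
  rewrite (_ : (fun l => _) = phi) //; apply/funext => l.
  by rewrite /phi; case: eqP.
exists drop_var; split; [|exact: P_k| |exact: nvars_drop_var]; last first.
  by apply/negP => /occurs_drop_var; rewrite eqxx andbF.
(* Expressing [drop_var] through the new coordinates amounts to the substitution [T0] in [P], so it
   remains to show that [T0] fixes [P]. *)
pose T0 := [tuple match split i with
                  | inl a => if a == k then 0 else hol (y a)
                  | inr a => if a == k then 0 else antihol (y a)
                  end | i < n + n].
rewrite /expressed_as (@drop_var_comp _ _ T0); first last.
- by move=> l lk; rewrite !tnth_mktuple !split_rshift (negPf lk) phi_new.
- by move=> l lk; rewrite !tnth_mktuple !split_lshift (negPf lk) phi_new.
- by rewrite tnth_mktuple split_rshift eqxx.
- by rewrite tnth_mktuple split_lshift eqxx.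
(* The reality of [P] turns invariance under [S0] into invariance under its
   conjugate, which acts on the zbar variables. *)
have {2}<- : conj_swap (conj_swap (P \mPo S0) \mPo S0) = P.
  by rewrite S0P !(leading_hermitian P_leading, S0P).
pose C := @conj_swap R n.
apply: (@mpoly_rmorph_ext _ _ _ (comp_mpoly T0)
  (C \o comp_mpoly S0 \o C \o comp_mpoly S0)) => [c|i] /=.
  by rewrite !(comp_mpolyC, conj_swapC) conjCK.
have S0_antihol p : antihol p \mPo S0 = antihol p.
  apply: (@mpoly_rmorph_ext _ _ _ (comp_mpoly S0 \o @antihol R n)
    (@antihol R n)) => [c|a] /=.
    by rewrite /antihol map_mpolyC !comp_mpolyC.
  by rewrite antiholXU comp_mpoly_tnth tnth_mktuple split_rshift.
rewrite !comp_mpoly_tnth !tnth_mktuple.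
elim/double_ind: i => a; rewrite ?(split_lshift, split_rshift).
  case: eqP => _; first by rewrite !(rmorph0, comp_mpoly0).
  by rewrite /C conj_swap_hol S0_antihol conj_swap_antihol.
rewrite /C conj_swapXU swap_rshift comp_mpoly_tnth tnth_mktuple split_lshift.
by case: eqP => _; rewrite ?rmorph0 ?conj_swap_hol.
Qed.

End Elimination.

(** * The equivalence at a step of the algorithm *)

Unset Implicit Arguments.

Theorem proposition1p3 (R : realType) (n N : nat)
    (f : 'I_N -> 'rV[R[i]]_n -> R[i])
    (f_hol : forall i, holomorphic_near0 (f i))
    (f_0 : forall i, f i 0 = 0)
    (finite_type : (DAngelo_1type f < +oo)%E)
    (j : nat) (g : 'I_N -> 'rV[R[i]]_n -> R[i]) (L : 'I_n -> rat)
    (step_j : Kolar_step f j g L)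
    (P : {mpoly R[i][n + n]}) (P_leading : is_leading L g P)
    (k : 'I_n) (k_occurs : occurs k P) :
  (exists phi : 'I_n -> {mpoly R[i][n]}, allowable L P k phi) <->
  dependent_row (Levi_matrix P) k.
Proof.
have [g_0 L_gt0] := Kolar_stepP f_0 step_j.
have P_like := leadingP g_0 P_leading.
split=> [[phi]|]; first exact: (allowable_dependent_row L_gt0 P_like).
exact: (dependent_row_allowable L_gt0 P_like).
Qed.
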